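(* Let $\pi=\pi_1\cdots\pi_n$ be a left-crucial permutation with respect to squares. Index the entries of any extension of $\pi$ to the left by positions $0,1,\dots,n$ (the new element in position $0$). Suppose that for some extension to the left of $\pi$, the factor in positions $0,\dots,7$ is order-isomorphic to the factor in positions $8,\dots,15$ (a square of length $16$). Then there is no extension to the left of $\pi$ in which the factor in positions $0,\dots,11$ is order-isomorphic to the factor in positions $12,\dots,23$ (a square of length $24$).
   Context: Permutations are written in one-line notation. A factor is a sequence of consecutive entries; two sequences of distinct numbers of equal length are order-isomorphic if their entries are in the same relative order. A square is a factor $XY$ with $X,Y$ consecutive, of equal length at least $2$, and order-isomorphic; its length is $2|X|$. A permutation is square-free if it contains no square. For $\pi=\pi_1\cdots\pi_n$ and $x\in\{1,\dots,n+1\}$, the extension of $\pi$ to the left by $x$ is the permutation $x\pi'_1\cdots\pi'_n$ where $\pi'_j=\pi_j$ if $\pi_j<x$ and $\pi'_j=\pi_j+1$ otherwise. A permutation is left-crucial with respect to squares if it is square-free but every extension of it to the left by every $x\in\{1,\dots,n+1\}$ contains a square. *)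

(* Defs.v *)
From mathcomp Require Import all_boot all_fingroup.

Set Implicit Arguments.
Unset Strict Implicit.
Unset Printing Implicit Defensive.

(* Ordinals start at 0, hence the successor: the entries are 1, ..., n. *)
Definition one_line n (p : 'S_n) : seq nat := [seq (p i).+1 | i <- enum 'I_n].

Definition factor (w : seq nat) (i l : nat) : seq nat := take l (drop i w).

Definition order_isomorphic (u v : seq nat) : Prop :=
  size u = size v /\
  forall i j, i < size u -> j < size u ->
    (nth 0 u i < nth 0 u j) = (nth 0 v i < nth 0 v j).

(* The bound on positions matters: [take] and [drop] silently truncate. *)
Definition square_at (w : seq nat) (i l : nat) : Prop :=
  [/\ 2 <= l, i + l.*2 <= size w &
      order_isomorphic (factor w i l) (factor w (i + l) l)].

Definition contains_square (w : seq nat) : Prop :=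
  exists i l, square_at w i l.

Definition square_free (w : seq nat) : Prop := ~ contains_square w.

(* The ordinal x stands for the new entry x.+1; see [one_line_extend_left]. *)
Definition extend_left n (x : 'I_n.+1) (p : 'S_n) : 'S_n.+1 :=
  lift_perm ord0 x p.

Definition left_crucial n (p : 'S_n) : Prop :=
  square_free (one_line p) /\
  forall x : 'I_n.+1, contains_square (one_line (extend_left x p)).

Lemma size_one_line n (p : 'S_n) : size (one_line p) = n.
Proof. by rewrite size_map size_enum_ord. Qed.

Lemma perm_one_line n (p : 'S_n) : perm_eq (one_line p) (iota 1 n).
Proof.
have -> : one_line p = [seq val i + 1 | i <- [seq p i | i <- enum 'I_n]].
  by rewrite -map_comp; apply: eq_map => i /=; rewrite addn1.
have -> : iota 1 n = [seq val i + 1 | i <- enum 'I_n].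
  rewrite (map_comp (addn^~ 1) val) val_enum_ord -[X in iota X]addn0 iotaDl.
  by apply: eq_map => i; rewrite addnC.
apply: perm_map; apply: uniq_perm; first last.
- move=> i; rewrite mem_enum; apply/mapP.
  by exists (p^-1%g i); rewrite ?mem_enum ?permKV.
- exact: enum_uniq.
- by rewrite map_inj_uniq ?enum_uniq //; apply: perm_inj.
Qed.

Lemma one_line_extend_left n (x : 'I_n.+1) (p : 'S_n) :
  one_line (extend_left x p) =
  x.+1 :: [seq if y < x.+1 then y else y.+1 | y <- one_line p].
Proof.
rewrite /one_line /extend_left enum_ordSl /= lift_perm_id; congr (_ :: _).
rewrite -!map_comp; apply: eq_map => i /=.
rewrite lift_perm_lift /= /bump ltnS.
by case: leqP.
Qed.

(* Main.v *)
Require Import Defs.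
From mathcomp Require Import all_boot all_fingroup.

(** If both squares existed, positions 1-4 of [pi] would be order-isomorphic to
    positions 9-12 (by the square of length 16) and to positions 13-16 (by the
    square of length 24), so positions 9-16 of [pi] itself would form a square
    of length 8, although [pi] is square-free. *)

Lemma nth_factor w i l k : k < l -> nth 0 (factor w i l) k = nth 0 w (i + k).
Proof. by move=> kl; rewrite nth_take // nth_drop. Qed.

Lemma size_factor w i l : i + l <= size w -> size (factor w i l) = l.
Proof.
move=> le_w; rewrite size_takel // size_drop leq_subRL //.
exact: leq_trans (leq_addr _ _) le_w.
Qed.

(** The old entries are relabelled by a strictly increasing map that skips [x.+1], so comparisons
    survive. *)
Lemma ltn_nth_extend_left n (x : 'I_n.+1) (p : 'S_n) i j : i < n -> j < n ->
  (nth 0 (one_line (extend_left x p)) i.+1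
     < nth 0 (one_line (extend_left x p)) j.+1) =
  (nth 0 (one_line p) i < nth 0 (one_line p) j).
Proof.
move=> lt_in lt_jn; rewrite one_line_extend_left /=.
rewrite !(nth_map 0) ?size_one_line //.
move: (nth 0 _ i) (nth 0 _ j) => a b.
case: (ltnP a x.+1) => ha; case: (ltnP b x.+1) => hb //.
  by rewrite ltnS (leq_trans ha hb) (ltnW (leq_trans ha hb)).
by rewrite [RHS]ltnNge (ltnW (leq_trans hb ha)) ltnNge
            (leqW (ltnW (leq_trans hb ha))).
Qed.

(** Deleting the first entry of each half leaves two order-isomorphic factors of length [l] inside
    [p]: the new entry goes, and so does its partner at index [l], hence the offset [l.+1]. *)
Lemma square_extend_left n (x : 'I_n.+1) (p : 'S_n) l :
  square_at (one_line (extend_left x p)) 0 l.+1 ->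
  l.*2.+1 <= n /\
  forall i j, i < l -> j < l ->
    (nth 0 (one_line p) i < nth 0 (one_line p) j) =
    (nth 0 (one_line p) (l.+1 + i) < nth 0 (one_line p) (l.+1 + j)).
Proof.
case=> _; rewrite size_one_line !add0n doubleS ltnS => le_ln [_ iso].
split=> // i j lt_il lt_jl.
have lt_n k : k < l -> l.+1 + k < n.
  by move=> lt_kl; apply: leq_trans le_ln; rewrite addSn -addnn !ltnS ltn_add2l.
have lt_n0 k : k < l -> k < n.
  by move=> /lt_n; apply: leq_ltn_trans; apply: leq_addl.
have := iso i.+1 j.+1.
rewrite size_factor; last first.
  by rewrite size_one_line ltnS (leq_trans _ le_ln) // -addnn leqW ?leq_addr.
rewrite !nth_factor ?ltnS // !add0n !addnS !ltn_nth_extend_left ?lt_n ?lt_n0 //.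
by apply.
Qed.

Theorem theorem2 (n : nat) (pi : 'S_n) (pi_crucial : left_crucial pi)
    (square16 : exists x : 'I_n.+1, square_at (one_line (extend_left x pi)) 0 8) :
  ~ exists x : 'I_n.+1, square_at (one_line (extend_left x pi)) 0 12.
Proof.
case: pi_crucial => sq_free _ [y /square_extend_left[le23n iso12]].
case: square16 => x /square_extend_left[_ iso8].
have le16 : 16 <= size (one_line pi).
  by rewrite size_one_line (leq_trans _ le23n).
(* Indices of [pi] start at 0: the halves begin at 8 and 8 + 4 = 12, the offsets in [iso8] and
   [iso12]. *)
apply: sq_free; exists 8, 4; split=> //; split.
  by rewrite !size_factor // (leq_trans _ le16).
move=> i j; rewrite size_factor; last by rewrite (leq_trans _ le16).
move=> lt_i4 lt_j4; rewrite !nth_factor //.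
have lt_i7 : i < 7 by apply: leq_trans lt_i4 _.
have lt_j7 : j < 7 by apply: leq_trans lt_j4 _.
(* The comparison passes from index 8 back to index 0, then on to index 12. *)
by rewrite -iso8 // iso12 // (leq_trans lt_i4, leq_trans lt_j4).
Qed.
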